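(* Let $X=(V,E)$ be a regular connected graph with a nonempty set $S$ of marked vertices. Fix a spanning tree $T$ and a marked vertex $a\in S$. Then the $1$-eigenspace of the transition matrix $U$ has the $\{0,\pm1\}$-basis $$\{z_e:e\in E\setminus E(T)\}\cup\{z_b:b\in S\setminus\{a\}\},$$ where the vectors $z_e,z_b\in\mathbb{R}^{\text{arcs}(X)}$ are defined as follows. (i) For each $e\in E\setminus E(T)$, choose a consistent orientation (direction of traversal) of the fundamental cycle containing $e$ relative to $T$; $z_e$ assigns $1$ to each arc of the cycle that follows this direction, $-1$ to its opposite arc, and $0$ to all other arcs. (ii) For each $b\in S\setminus\{a\}$, choose a path from $a$ to $b$ traversed from $a$ to $b$; $z_b$ assigns $1$ to each arc along the path following this direction, $-1$ to its opposite arc, and $0$ to all other arcs.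
   Context: $X$ is $k$-regular. An arc is an ordered pair $(u,v)$ of adjacent vertices ($u$ the tail). $R$ is the arc-reversal permutation matrix; $D_t$ is the $V\times\text{arcs}$ tail incidence matrix with $(D_t)_{x,(u,v)}=1$ iff $x=u$; $O_S$ is the identity matrix with its $[S,S]$ block zeroed. The transition matrix is $U=R\left(\frac{2}{k}D_t^TO_SD_t-I\right)$ (Grover coin at unmarked vertices, $-I$ coin at marked vertices). *)

(* Defs.v *)
From mathcomp Require Import all_boot all_order all_algebra.
From mathcomp Require Import reals.

Set Implicit Arguments.
Unset Strict Implicit.
Unset Printing Implicit Defensive.

Import GRing.Theory.
Local Open Scope ring_scope.

(* A graph on V is given by its adjacency relation; simplicity (symmetry and
   irreflexivity) is assumed where it is needed. *)
Section Graphs.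
Variable V : finType.
Implicit Types (g t : rel V) (c p : seq V) (e : {set V}).

Definition connected_graph g : Prop := forall x y : V, connect g x y.

Definition regular_graph g (k : nat) : Prop :=
  forall x : V, #|[set y | g x y]| = k.

Definition edges g : {set {set V}} :=
  [set [set p.1; p.2] | p : V * V & g p.1 p.2].

(* The cyclic list c of vertices is traversed in its order. The bound on the
   length excludes going back and forth along a single edge. *)
Definition is_cycle g c : bool := (2 < size c)%N && ucycleb g c.

(* A path from a to b is given by the list p of its vertices after a. *)
Definition is_path g (a b : V) p : bool :=
  [&& path g a p, last a p == b & uniq (a :: p)].

Record spanning_tree g t : Prop := SpanningTree {
  spanning_tree_sym : symmetric t;
  spanning_tree_sub : subrel t g;
  spanning_tree_connected : connected_graph t;
  spanning_tree_acyclic : forall c, ~~ is_cycle t c }.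

Definition add_edge t e : rel V := [rel u v | t u v || ([set u; v] == e)].

Definition cycle_arcs c : seq (V * V) := zip c (rot 1 c).
Definition path_arcs (a : V) p : seq (V * V) := zip (a :: p) p.

(* c lists, in one of its two directions, the cycle of T + e through e. *)
Definition fundamental_cycle t e c : bool :=
  is_cycle (add_edge t e) c &&
  (e \in [seq [set u.1; u.2] | u <- cycle_arcs c]).

Definition arc g : finType := {u : V * V | g u.1 u.2}.

Definition opp_pair (u : V * V) : V * V := (u.2, u.1).

End Graphs.

(* Matrices indexed by vertices and arcs are indexed by 'I_#|V| and
   'I_#|arc g| through enum_val. *)
Section Walk.
Variables (R : realType) (V : finType) (g : rel V).

Definition arc_at (i : 'I_#|arc g|) : V * V := sval (enum_val i).

Definition arc_reversal_mx : 'M[R]_#|arc g| :=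
  \matrix_(i, j) (arc_at i == opp_pair (arc_at j))%:R.

Definition tail_mx : 'M[R]_(#|V|, #|arc g|) :=
  \matrix_(i, j) (enum_val i == (arc_at j).1)%:R.

Definition unmarked_mx (S : {set V}) : 'M[R]_#|V| :=
  \matrix_(i, j) if (enum_val i \in S) && (enum_val j \in S) then 0
                 else (1%:M : 'M[R]_#|V|) i j.

(* For k = 0 the scalar 2 / k is 0, but then there are no arcs. *)
Definition transition_mx (k : nat) (S : {set V}) : 'M[R]_#|arc g| :=
  arc_reversal_mx *m
    ((2 / k%:R) *: (tail_mx^T *m unmarked_mx S *m tail_mx) - 1%:M).

(* eigenspace (from mxalgebra) concerns row vectors; here matrices
   act on column vectors. *)
Definition col_eigenspace (n : nat) (A : 'M[R]_n) (a : R) : {vspace 'cV[R]_n} :=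
  passmx.leigenspace (linfun (mulmx A : 'cV[R]_n -> 'cV[R]_n)) a.

Definition signed_arc_vec (s : seq (V * V)) : 'cV[R]_#|arc g| :=
  \col_i (if arc_at i \in s then 1
          else if opp_pair (arc_at i) \in s then -1 else 0).

End Walk.

Arguments transition_mx R {V} g k S.
Arguments signed_arc_vec R {V} g s.

(* Main.v *)
Require Import Defs.
From HB Require Import structures.
From mathcomp Require Import all_boot all_order all_algebra.
From mathcomp Require Import reals.

Set Implicit Arguments.
Unset Strict Implicit.
Unset Printing Implicit Defensive.

Import GRing.Theory.
Local Open Scope ring_scope.

(* Reading [U z = z] arc by arc, [z(u,v) + z(v,u)] equals a quantity that depends
   on the endpoint [v] only, hence on [u] only, hence is constant by
   connectedness; it vanishes at marked vertices. So the 1-eigenspace consists of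
   the antisymmetric arc functions (flows) whose net outflow vanishes at every
   unmarked vertex. The outflow at [b] detects [z_b] and kills every other [z_b']
   and every [z_e]; the value on an arc over [e] detects [z_e] among the [z_e'].
   This triangular system of functionals gives independence, and subtracting the
   appropriate combination from a flow in the eigenspace leaves a circulation
   supported on the tree, which is zero since its support has no leaves. *)

(** * Edges as unordered pairs *)

Lemma set2_eq (V : finType) (u v : V * V) :
  [set u.1; u.2] = [set v.1; v.2] -> u = v \/ u = opp_pair v.
Proof.
case: u v => [x y] [x' y'] /= eq_uv; rewrite /opp_pair /=.
have: x \in [set x'; y'] by rewrite -eq_uv set21.
have: y \in [set x'; y'] by rewrite -eq_uv set22.
have: x' \in [set x; y] by rewrite eq_uv set21.
have: y' \in [set x; y] by rewrite eq_uv set22.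
by rewrite !in_set2 => /pred2P[]? /pred2P[]? /pred2P[]? /pred2P[]?; subst;
  auto.
Qed.

Lemma mem_edges (V : finType) (g : rel V) (u : V * V) :
  symmetric g -> ([set u.1; u.2] \in edges g) = g u.1 u.2.
Proof.
move=> g_sym; apply/imsetP/idP => [[v]|gu]; last by exists u; rewrite ?inE.
by rewrite inE => gv /set2_eq[] -> //=; rewrite g_sym.
Qed.

(** * Arcs along paths and cycles *)

Section DirectedArcs.
Variable V : finType.
Implicit Types (g : rel V) (p c : seq V) (s : seq (V * V)).

(** Under this condition the order of the tests in [signed_arc_vec] is immaterial: the vector is a
    difference of two indicators. *)
Definition no_opposite s := forall u, u \in s -> opp_pair u \notin s.

Lemma opp_pairK : involutive (@opp_pair V).
Proof. by case. Qed.

Lemma path_arcs_cons x y p :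
  path_arcs x (y :: p) = (x, y) :: path_arcs y p.
Proof. by []. Qed.

(** [zip] drops the surplus last vertex, so a cycle becomes the closed walk from its head and the
    facts on paths apply. *)
Lemma cycle_arcs_cons x p : cycle_arcs (x :: p) = path_arcs x (rcons p x).
Proof.
rewrite /cycle_arcs rot1_cons /path_arcs.
suff zipE: forall (y z : V) q, zip (y :: q) (rcons q z)
    = zip (y :: rcons q z) (rcons q z) by exact: zipE.
by move=> y z q; elim: q y => //= w q IHq y; rewrite IHq.
Qed.

Lemma path_arcs_adj g x p : path g x p -> {in path_arcs x p, forall u, g u.1 u.2}.
Proof.
elim: p x => [|y p IHp] x //= /andP[gxy gp] u.
by rewrite path_arcs_cons inE => /predU1P[-> //|]; apply: IHp.
Qed.

Lemma unzip1_path_arcs x p : unzip1 (path_arcs x p) = belast x p.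
Proof. by elim: p x => //= y p IHp x; rewrite -IHp. Qed.

Lemma unzip2_path_arcs x p : unzip2 (path_arcs x p) = p.
Proof. by rewrite unzip2_zip /=. Qed.

Lemma path_arcs_fst x p u : u \in path_arcs x p -> u.1 \in belast x p.
Proof. by move=> /(map_f fst); rewrite -/(unzip1 _) unzip1_path_arcs. Qed.

Lemma path_arcs_snd x p u : u \in path_arcs x p -> u.2 \in p.
Proof. by move=> /(map_f snd); rewrite -/(unzip2 _) unzip2_path_arcs. Qed.

Lemma no_opposite_cons u s :
  u.1 != u.2 -> opp_pair u \notin s -> no_opposite s -> no_opposite (u :: s).
Proof.
move=> u_neq u's s_no v; rewrite !inE => /predU1P[->|vs].
  rewrite (negPf u's) orbF; apply: contra u_neq => /eqP.
  by case: (u) => x y [->].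
rewrite (negPf (s_no _ vs)) orbF.
by apply: contra u's => /eqP <-; rewrite opp_pairK.
Qed.

Lemma path_arcs_no_opposite x p : uniq (x :: p) -> no_opposite (path_arcs x p).
Proof.
elim: p x => [|y p IHp] x; first by move=> _ u; rewrite in_nil.
move=> /= /andP[x_yp yp_uniq].
rewrite path_arcs_cons; apply: no_opposite_cons; last exact: IHp.
  by apply: contra x_yp => /= /eqP ->; rewrite mem_head.
by apply: contra x_yp => /path_arcs_snd /= x_p; rewrite inE x_p orbT.
Qed.

(** Without its first arc [(x, y)] the cycle is a path from [y] to [x] with distinct vertices. Its
    only arc with tail [y] is [(y, w)], and [w] is not [x] because there are at least three
    vertices. *)
Lemma cycle_arcs_no_opposite c :
  uniq c -> (2 < size c)%N -> no_opposite (cycle_arcs c).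
Proof.
case: c => [|x [|y [|w q]]] // c_uniq _; rewrite cycle_arcs_cons.
have yx_uniq: uniq (y :: rcons (w :: q) x).
  by rewrite -[uniq _]/(uniq (rcons [:: y, w & q] x)) -rot1_cons rot_uniq.
move: c_uniq => /= /and4P[x_yp y_wq w_q q_uniq].
rewrite path_arcs_cons; apply: no_opposite_cons.
- by apply: contra x_yp => /= /eqP ->; rewrite mem_head.
- rewrite /opp_pair /= path_arcs_cons inE negb_or; apply/andP; split.
    apply: contra x_yp => /eqP[->]; by rewrite !inE eqxx orbT.
  apply: contra y_wq => /path_arcs_fst /=.
  by rewrite belast_rcons.
- exact: path_arcs_no_opposite.
Qed.

Lemma path_arcs_uniq x p : uniq (x :: p) -> uniq (path_arcs x p).
Proof. by move=> /andP[_ p_uniq]; apply: zip_uniqr. Qed.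

Lemma cycle_arcs_adj g c : cycle g c -> {in cycle_arcs c, forall u, g u.1 u.2}.
Proof. by case: c => // x p gc; rewrite cycle_arcs_cons; apply: path_arcs_adj. Qed.

(** Serves to compute the outflow of a signed arc vector. Membership ignores multiplicity whereas
    the count does not, hence [uniq]. *)
Lemma sum_mem_fst (R : pzRingType) s x :
  uniq s -> \sum_y ((x, y) \in s)%:R = (count_mem x (unzip1 s))%:R :> R.
Proof.
elim: s => [_|[x' y'] s IHs /= /andP[us s_uniq]]; first by rewrite big1.
rewrite natrD -(IHs s_uniq) (eq_bigr (fun y => ((x, y) == (x', y'))%:R
   + ((x, y) \in s)%:R)) => [|y _].
  rewrite big_split /=; congr (_ + _).
  rewrite (bigD1 y') //= big1 => [|y /negPf ne]; last first.
    by rewrite xpair_eqE ne andbF.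
  by rewrite addr0 xpair_eqE eqxx andbT eq_sym.
rewrite inE; case: eqP => [->|_] /=; last by rewrite add0r.
by rewrite (negPf us) addr0.
Qed.

Lemma sum_mem_snd (R : pzRingType) s x :
  uniq s -> \sum_y ((y, x) \in s)%:R = (count_mem x (unzip2 s))%:R :> R.
Proof.
move=> s_uniq; have := sum_mem_fst R (s := map (@opp_pair V) s) x.
rewrite (map_inj_uniq (inv_inj opp_pairK)) => /(_ s_uniq).
rewrite /unzip1 -map_comp => <-; apply: eq_bigr => y _.
by rewrite -[(x, y)]/(opp_pair (y, x)) mem_map //; apply: inv_inj opp_pairK.
Qed.

(* Extending a path at its head, the new vertex eventually lies on the path
   already, and then a cycle closes up. *)
Lemma min_degree2_cycle g x y :
  symmetric g -> irreflexive g ->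
  (forall u v, g u v -> exists2 w, w != u & g v w) ->
  g x y -> exists c, is_cycle g c.
Proof.
move=> g_sym g_irr g_next gxy.
(* [n] is fuel: each extension trades one unit of it for a new vertex, and at [n = 0] the distinct
   vertices would outnumber [V]. *)
have grow n : forall x y p, path g x (y :: p) -> uniq [:: x, y & p] ->
    (#|V| < n + size p)%N -> exists c, is_cycle g c.
  elim: n => [|n IHn] {gxy}x {}y p gp p_uniq lt_n.
    have /card_uniqP sz := p_uniq.
    have := max_card (mem [:: x, y & p]); rewrite sz /= => le_p.
    by move: (leq_trans le_p (ltnW lt_n)); rewrite add0n ltnNge leqnSn.
  have /andP[gxy _] := gp.
  have [|w w_y gxw] := g_next y x; first by rewrite g_sym.
  case: (boolP (w \in [:: x, y & p])) => w_p; last first.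
    apply: (IHn w x (y :: p)); first by rewrite /= g_sym gxw.
      by rewrite cons_uniq w_p.
    by rewrite /= addnS.
  (* [w] differs from [x] and from [y], so the cycle that it closes has at least three vertices. *)
  move: w_p; rewrite !inE (negPf w_y) /= => /predU1P[w_x|w_p].
    by rewrite w_x g_irr in gxw.
  move: gp p_uniq; case/splitPr: w_p => p1 p2.
  rewrite -cat_rcons -!cat_cons cat_path cat_uniq.
  move=> /andP[gp _] /and3P[p_uniq _ _]; exists [:: x, y & rcons p1 w].
  rewrite /is_cycle /ucycleb p_uniq andbT; apply/andP; split.
    by rewrite /= size_rcons.
  rewrite -[cycle _ _]/(path g x (rcons (y :: rcons p1 w) x)) rcons_path gp.
  by rewrite /= last_rcons g_sym.
have x_y : x != y by apply: contraTneq gxy => ->; rewrite g_irr.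
by apply: (grow #|V|.+1 x y [::]); rewrite /= ?gxy ?inE ?x_y ?addn0.
Qed.

End DirectedArcs.

(** * Independence and reduction by a system of functionals *)

Section TriangularBasis.
Variables (K : fieldType) (vT : vectType K) (I : eqType).
Variables (s : seq I) (f : I -> vT) (phi : I -> {scalar vT}).
Hypothesis phi_diag : {in s, forall i, phi i (f i) != 0}.
Hypothesis phi_off : {in s &, forall i j, i != j -> phi i (f j) = 0}.

Lemma scalar_span0 (h : {scalar vT}) (X : seq vT) :
  {in X, forall x, h x = 0} -> {in <<X>>%VS, forall x, h x = 0}.
Proof.
move=> hX x; rewrite -[X](in_tupleE) => /coord_span ->.
rewrite linear_sum big1 // => i _; rewrite linearZ /= hX ?mulr0 //.
exact: mem_nth.
Qed.

(** [phi i] kills [X] and all later [f j] but not [f i], so [f i] lies outside their span. *)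
Lemma free_map_cat (X : seq vT) :
  uniq s -> free X -> {in s & X, forall i x, phi i x = 0} -> free (map f s ++ X).
Proof.
move=> + X_free; move: phi_diag phi_off.
elim: s => [//|i s' IHs] diag off /= /andP[i_s' s'_uniq] phiX.
rewrite free_cons IHs // ?andbT.
- apply: (contra _ (diag i (mem_head _ _))) => fi_span; apply/eqP.
  apply: (scalar_span0 _ fi_span) => x; rewrite mem_cat => /orP[].
    case/mapP=> j j_s' ->; apply: off; rewrite ?mem_head // ?inE ?j_s' ?orbT //.
    by apply: contraNneq i_s' => ->.
  by apply: phiX; rewrite mem_head.
- by move=> j js; apply: diag; rewrite inE js orbT.
- by move=> j l js ls; apply: off; rewrite inE ?js ?ls orbT.
- by move=> j x js; apply: phiX; rewrite inE js orbT.
Qed.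

(** As [phi] is diagonal on [f], dividing [phi j z] by [phi j (f j)] gives the coefficients to
    subtract. *)
Lemma reduce_modulo_span (z : vT) : uniq s ->
  exists2 w, w \in <<map f s>>%VS & {in s, forall i, phi i (z - w) = 0}.
Proof.
move=> s_uniq; exists (\sum_(j <- s) (phi j z / phi j (f j)) *: f j).
  rewrite big_seq; apply: memv_suml => j js.
  by apply/memvZ/memv_span/map_f.
move=> i is'; rewrite linearB linear_sum (bigD1_seq i) //= big_seq_cond big1.
  by rewrite linearZ /= divfK ?phi_diag // addr0 subrr.
by move=> j /andP[js j_i]; rewrite linearZ /= (phi_off is' js) ?mulr0 // eq_sym.
Qed.

End TriangularBasis.

(** * Arc functions as flows *)

Section Flows.
Variables (R : realType) (V : finType) (g : rel V).
Hypothesis g_sym : symmetric g.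
Implicit Types (z : 'cV[R]_#|Defs.arc g|) (s : seq (V * V)) (u : V * V) (x : V).

(** A common form for [flow] and [outflow], so that a single proof of linearity makes both of them
    functionals. *)
Definition arc_sum (P : pred 'I_#|Defs.arc g|) z : R := \sum_(i | P i) z i 0.

Lemma arc_sum_is_linear P : scalar (arc_sum P).
Proof.
move=> c y z; rewrite /arc_sum mulr_sumr -big_split /=.
by apply: eq_bigr => i _; rewrite !mxE.
Qed.

HB.instance Definition _ P :=
  GRing.isLinear.Build R 'cV[R]_#|Defs.arc g| R _ (arc_sum P) (arc_sum_is_linear P).

(** The sum has at most one term: it extends the entries of [z] by 0 to all pairs of vertices, which
    avoids arc indices. *)
Definition flow u : {scalar 'cV[R]_#|Defs.arc g|} :=
  arc_sum (fun i => arc_at i == u).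

Definition outflow x : {scalar 'cV[R]_#|Defs.arc g|} :=
  arc_sum (fun i => (arc_at i).1 == x).

Lemma arc_at_inj : injective (@arc_at V g).
Proof. by move=> i j /val_inj /enum_val_inj. Qed.

Lemma arc_at_adj (i : 'I_#|Defs.arc g|) : g (arc_at i).1 (arc_at i).2.
Proof. exact: valP (enum_val i). Qed.

Lemma arc_at_onto u : g u.1 u.2 -> exists i : 'I_#|Defs.arc g|, arc_at i = u.
Proof.
move=> gu; exists (enum_rank (exist _ u gu : Defs.arc g)).
by rewrite /arc_at enum_rankK.
Qed.

Lemma flow_arc_at z i : flow (arc_at i) z = z i 0.
Proof.
by rewrite /= /arc_sum (eq_bigl (pred1 i)) ?big_pred1_eq // => j;
  rewrite (inj_eq arc_at_inj).
Qed.

Lemma flow_nonadj z u : ~~ g u.1 u.2 -> flow u z = 0.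
Proof.
move=> gu; rewrite /= /arc_sum big1 // => i /eqP iu.
by rewrite -iu arc_at_adj in gu.
Qed.

Lemma flow_eq0 z : (forall u, flow u z = 0) -> z = 0.
Proof. by move=> z0; apply/matrixP => i j; rewrite ord1 -flow_arc_at z0 mxE. Qed.

Lemma outflowE z x : outflow x z = \sum_y flow (x, y) z.
Proof.
by rewrite /= /arc_sum (partition_big (fun i => (arc_at i).2) xpredT).
Qed.

Definition antisymmetric_flow z := forall u, flow (opp_pair u) z = - flow u z.

(** Reversing all arcs shows that the total equals its own negative. *)
Lemma outflow_sum0 z : antisymmetric_flow z -> \sum_x outflow x z = 0.
Proof.
move=> z_anti; rewrite (eq_bigr _ (fun x _ => outflowE z x)) pair_bigA /=.
set t := (X in X = 0); have tN : t = - t.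
  rewrite {1}/t (reindex_inj (inv_inj (@opp_pairK V))) -sumrN.
  by apply: eq_bigr => -[x y] _; apply: (z_anti (x, y)).
by apply/eqP; rewrite -Num.Theory.eqNr -tN.
Qed.

(** * Signed vectors of arc lists *)

Section SignedArcs.
Variable s : seq (V * V).
Hypotheses (s_uniq : uniq s) (s_no : no_opposite s).
Hypothesis s_adj : {in s, forall u, g u.1 u.2}.
Let zs := signed_arc_vec R g s.

Lemma flow_signed_arc_vec u :
  flow u zs = (u \in s)%:R - (opp_pair u \in s)%:R.
Proof.
case: (boolP (g u.1 u.2)) => gu; last first.
  rewrite flow_nonadj //; case: (boolP (u \in s)) => [/s_adj/idPn//|_].
  case: (boolP (opp_pair u \in s)) => [/s_adj|_]; last by rewrite subrr.
  by rewrite /= g_sym (negPf gu).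
have [i <-] := arc_at_onto gu; rewrite flow_arc_at mxE.
case: (boolP (arc_at i \in s)) => [/s_no/negPf->|_]; first by rewrite subr0.
by case: ifP; rewrite sub0r ?oppr0.
Qed.

Lemma signed_arc_vec_anti : antisymmetric_flow zs.
Proof. by move=> u; rewrite !flow_signed_arc_vec opp_pairK opprB. Qed.

Lemma outflow_signed_arc_vec x :
  outflow x zs = (count_mem x (unzip1 s))%:R - (count_mem x (unzip2 s))%:R.
Proof.
rewrite outflowE (eq_bigr _ (fun y _ => flow_signed_arc_vec (x, y))).
by rewrite sumrB sum_mem_fst // sum_mem_snd.
Qed.

End SignedArcs.

(** The heads along a cycle are a rotation of the tails, so the two counts agree. *)
Lemma outflow_cycle c x : is_cycle g c ->
  outflow x (signed_arc_vec R g (cycle_arcs c)) = 0.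
Proof.
case/and3P=> c_size gc c_uniq; rewrite outflow_signed_arc_vec.
- rewrite unzip1_zip ?unzip2_zip ?size_rot //.
  by rewrite (permP (permEl (perm_rot 1 c))) subrr.
- exact: zip_uniql.
- exact: cycle_arcs_no_opposite.
- exact: cycle_arcs_adj.
Qed.

(** The tails are all vertices of the path but the last, the heads all but the first; the counts
    differ only at the ends. *)
Lemma outflow_path a b p x : is_path g a b p ->
  outflow x (signed_arc_vec R g (path_arcs a p)) = (a == x)%:R - (b == x)%:R.
Proof.
case/and3P=> gp /eqP <- p_uniq; rewrite outflow_signed_arc_vec.
- rewrite unzip1_path_arcs unzip2_path_arcs.
  apply/eqP; rewrite subr_eq addrAC eq_sym subr_eq -!natrD.
  have := congr1 (count_mem x) (lastI a p); rewrite -cats1 count_cat /= addn0.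
  by move=> ->; rewrite addnC.
- exact: path_arcs_uniq.
- exact: path_arcs_no_opposite.
- exact: path_arcs_adj.
Qed.

(** In the support of [z], a vertex with one neighbour only would have that nonzero flow as its
    outflow. So every edge of the support can be continued, and a nonzero [z] would yield a cycle in
    [t]. *)
Lemma acyclic_circulation_eq0 (t : rel V) z :
  symmetric t -> irreflexive t -> (forall c, ~~ is_cycle t c) ->
  antisymmetric_flow z -> (forall x, outflow x z = 0) ->
  (forall u, ~~ t u.1 u.2 -> flow u z = 0) -> z = 0.
Proof.
move=> t_sym t_irr t_acyc z_anti z_div z_supp.
pose h := [rel x y | flow (x, y) z != 0].
have h_sub : subrel h t.
  by move=> x y /=; apply: contraR => txy; rewrite (z_supp (x, y)).
have h_sym : symmetric h.
  by move=> x y; rewrite /= -[(y, x)]/(opp_pair (x, y)) z_anti oppr_eq0.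
have h_irr : irreflexive h.
  by move=> x; apply: contraFF (t_irr x); apply: h_sub.
apply: flow_eq0 => -[x y]; apply/eqP/negP => /negP hxy.
have [] := min_degree2_cycle h_sym h_irr _ hxy; last first.
  move=> c /and3P[c_size hc c_uniq]; apply/negP: (t_acyc c).
  by rewrite /is_cycle c_size /ucycleb c_uniq (sub_cycle h_sub hc).
move=> {hxy}{}x {}y hxy; apply/exists_inP; apply: contraT.
rewrite negb_exists_in => /forall_inP h0.
move: (z_div y); rewrite outflowE (bigD1 x) //= big1 => [|w w_x]; last first.
  by apply/eqP; have := h0 w w_x; rewrite negbK.
by rewrite addr0 => /eqP; move: hxy; rewrite h_sym => /negPf ->.
Qed.

Lemma tail_mx_mulE z i : (tail_mx R g *m z) i 0 = outflow (enum_val i) z.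
Proof.
rewrite mxE /= /arc_sum [RHS]big_mkcond; apply: eq_bigr => j _.
by rewrite mxE eq_sym; case: eqP; rewrite ?mul1r ?mul0r.
Qed.

(** * The transition matrix and its 1-eigenspace *)

Section Eigenspace.
Variables (k : nat) (S : {set V}).
(** The entry of [(2/k) D_t^T O_S D_t z] at every arc with tail [x]. *)
Let coin z x : R := 2 / k%:R * (if x \in S then 0 else outflow x z).

(** Row [u] of the reversal matrix selects the arc opposite to [u], whose tail is [u.2]. *)
Lemma flow_transition_mx z u : g u.1 u.2 ->
  flow u (transition_mx R g k S *m z) = coin z u.2 - flow (opp_pair u) z.
Proof.
move=> gu; have [i iu] := arc_at_onto gu.
have gu' : g (opp_pair u).1 (opp_pair u).2 by rewrite g_sym.
have [j ju] := arc_at_onto gu'.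
rewrite -ju -iu !flow_arc_at iu /transition_mx -mulmxA mxE (bigD1 j) //=.
rewrite big1 ?addr0 => [|l lj]; last first.
  rewrite mxE iu; case: eqP => [ul|_]; last by rewrite mul0r.
  by case/eqP: lj; apply: arc_at_inj; rewrite ju ul opp_pairK.
rewrite mxE iu ju opp_pairK eqxx mul1r mulmxBl mul1mx mxE [in X in _ + X]mxE.
congr (_ - _); rewrite -scalemxAl mxE /coin; congr (_ * _).
rewrite -!mulmxA mxE (bigD1 (enum_rank u.2)) //= big1 => [|x x_u]; last first.
  rewrite !mxE ju; case: eqP => [xu|_]; last by rewrite mul0r.
  by case/eqP: x_u; rewrite -[u.2]xu enum_valK.
rewrite !mxE ju enum_rankK eqxx mul1r addr0 (bigD1 (enum_rank u.2)) //= big1.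
  rewrite tail_mx_mulE !mxE enum_rankK andbb eqxx.
  by case: ifP; rewrite ?mul0r ?mul1r addr0.
move=> x x_u; rewrite !mxE eq_sym (negPf x_u) if_same mul0r //.
Qed.

Lemma mem_eigenspace1 a z :
  connected_graph g -> regular_graph g k -> a \in S ->
  reflect (antisymmetric_flow z /\ forall x, x \notin S -> outflow x z = 0)
          (z \in col_eigenspace (transition_mx R g k S) 1).
Proof.
move=> g_conn g_reg aS.
rewrite memv_ker scale1r add_lfunE opp_lfunE id_lfunE lfunE subr_eq0.
apply: (iffP eqP) => [Uz | [z_anti z_div]].
  have coin_edge u : g u.1 u.2 -> coin z u.2 = flow u z + flow (opp_pair u) z.
    by move=> gu; rewrite -{2}Uz flow_transition_mx // subrK.
  (* The right-hand side of [coin_edge] does not change when the arc is reversed. *)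
  have coin_eq x y : g x y -> coin z x = coin z y.
    move=> gxy; rewrite (coin_edge (x, y)) // addrC.
    by rewrite -(coin_edge (y, x)) //= g_sym.
  have coin0 x : coin z x = 0.
    have /connectP[p gp ->] := g_conn a x.
    have : coin z a = 0 by rewrite /coin aS mulr0.
    elim: p a gp {aS} => //= y p IHp b /andP[/coin_eq -> gp]; exact: IHp.
  split=> [u|x xS].
    case: (boolP (g u.1 u.2)) => gu; last by rewrite !flow_nonadj ?oppr0 // g_sym.
    by apply/eqP; rewrite -addr_eq0 addrC -coin_edge ?coin0.
  (* The factor [2 / k] vanishes only for [k = 0]; then [x] has no neighbour and its outflow is 0
     anyway. *)
  move/eqP: (coin0 x); rewrite /coin (negPf xS) mulf_eq0 => /orP[|/eqP //].
  rewrite mulf_eq0 Num.Theory.pnatr_eq0 /= invr_eq0 Num.Theory.pnatr_eq0 -(g_reg x) cards_eq0.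
  move=> /eqP gx0; rewrite outflowE big1 // => y _; apply: flow_nonadj => /=.
  by have := in_set0 y; rewrite -gx0 inE => ->.
have coin0 x : coin z x = 0.
  by rewrite /coin; case: ifPn => [_|/z_div->]; rewrite mulr0.
apply/eqP; rewrite -subr_eq0; apply/eqP/flow_eq0 => u; rewrite linearB /=.
case: (boolP (g u.1 u.2)) => gu; last by rewrite !flow_nonadj ?subrr.
by rewrite flow_transition_mx // coin0 z_anti sub0r opprK subrr.
Qed.

End Eigenspace.
End Flows.

(** * The basis of cycle and path vectors *)

Theorem theorem3p3 (R : realType) (V : finType) (adj : rel V)
    (adj_sym : symmetric adj) (adj_irr : irreflexive adj)
    (k : nat) (adj_reg : regular_graph adj k)
    (adj_conn : connected_graph adj)
    (S : {set V}) (S_neq0 : S != set0)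
    (T : rel V) (T_tree : spanning_tree adj T)
    (a : V) (a_in_S : a \in S)
    (cyc : {set V} -> seq V)
    (cycP : forall e : {set V}, e \in edges adj :\: edges T ->
       fundamental_cycle T e (cyc e))
    (pth : V -> seq V)
    (pthP : forall b : V, b \in S :\ a -> is_path adj a b (pth b)) :
  let B :=
    [seq signed_arc_vec R adj (cycle_arcs (cyc e))
       | e <- enum (edges adj :\: edges T)] ++
    [seq signed_arc_vec R adj (path_arcs a (pth b)) | b <- enum (S :\ a)] in
  basis_of (col_eigenspace (transition_mx R adj k S) 1) B /\
  (forall z, z \in B -> forall i, z i 0 \in [:: 0; 1; -1]).
Proof.
move=> B; have T_irr : irreflexive T.
  by move=> x; apply: contraFF (adj_irr x); apply: (spanning_tree_sub T_tree).
have T_sym := spanning_tree_sym T_tree.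
have EP u : ([set u.1; u.2] \in edges adj :\: edges T)
    = ~~ T u.1 u.2 && adj u.1 u.2 by rewrite inE !mem_edges.
have add_adj e : e \in edges adj :\: edges T -> subrel (add_edge T e) adj.
  move=> eE x y /orP[/(spanning_tree_sub T_tree)//|/eqP exy].
  by move: eE; rewrite -exy (EP (x, y)) => /andP[].
have cyc_cycle e : e \in edges adj :\: edges T -> is_cycle adj (cyc e).
  move=> eE; have /andP[/and3P[c_size gc c_uniq] _] := cycP e eE.
  by rewrite /is_cycle c_size /ucycleb c_uniq (sub_cycle (add_adj e eE) gc).
(* A choice of an arc of [cyc e] lying over [e]. The implication makes the existence hold for every
   [e], as [xchoose] requires; [(a, a)] is a dummy. *)
have rep_ex e : exists u, (e \in edges adj :\: edges T) ==>
    (u \in cycle_arcs (cyc e)) && ([set u.1; u.2] == e).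
  case: (boolP (e \in _)) => eE; last by exists (a, a).
  by have /andP[_ /mapP[u uc ue]] := cycP e eE; exists u; rewrite uc -ue eqxx.
pose rep e := xchoose (rep_ex e).
have repP e : e \in edges adj :\: edges T ->
    rep e \in cycle_arcs (cyc e) /\ [set (rep e).1; (rep e).2] = e.
  by move=> eE; have /implyP/(_ eE)/andP[? /eqP] := xchooseP (rep_ex e).
pose ze e := signed_arc_vec R adj (cycle_arcs (cyc e)).
pose zb b := signed_arc_vec R adj (path_arcs a (pth b)).
have cyc_arcs e : e \in edges adj :\: edges T ->
    [/\ uniq (cycle_arcs (cyc e)), no_opposite (cycle_arcs (cyc e))
      & {in cycle_arcs (cyc e), forall u, adj u.1 u.2}].
  move=> /cyc_cycle/and3P[c_size gc c_uniq].
  split; [exact: zip_uniql | exact: cycle_arcs_no_opposite |].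
  exact: cycle_arcs_adj.
have pth_arcs b : b \in S :\ a ->
    [/\ uniq (path_arcs a (pth b)), no_opposite (path_arcs a (pth b))
      & {in path_arcs a (pth b), forall u, adj u.1 u.2}].
  move=> /pthP/and3P[gp _ p_uniq].
  split; [exact: path_arcs_uniq | exact: path_arcs_no_opposite |].
  exact: path_arcs_adj.
have ze_anti e : e \in edges adj :\: edges T -> antisymmetric_flow (ze e).
  by move=> /cyc_arcs[*]; apply: signed_arc_vec_anti.
have zb_anti b : b \in S :\ a -> antisymmetric_flow (zb b).
  by move=> /pth_arcs[*]; apply: signed_arc_vec_anti.
have ze_div e x : e \in edges adj :\: edges T -> outflow R adj x (ze e) = 0.
  by move=> eE; apply: outflow_cycle => //; apply: cyc_cycle.
have zb_div b x : b \in S :\ a -> outflow R adj x (zb b) = (a == x)%:R - (b == x)%:R.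
  by move=> bS; apply: outflow_path => //; apply: pthP.
have ze_diag : {in enum (edges adj :\: edges T), forall e,
    flow R adj (rep e) (ze e) != 0}.
  move=> e; rewrite mem_enum => eE; have [uc _] := repP e eE.
  have [c_uniq c_no c_adj] := cyc_arcs e eE.
  by rewrite flow_signed_arc_vec // uc (negPf (c_no _ uc)) subr0 oner_eq0.
have ze_off : {in enum (edges adj :\: edges T) &, forall e e', e != e' ->
    flow R adj (rep e) (ze e') = 0}.
  move=> e e'; rewrite !mem_enum => eE eE' ne; have [_ ue] := repP e eE.
  have [c_uniq c_no c_adj] := cyc_arcs e' eE'.
  have /andP[/and3P[_ gc _] _] := cycP e' eE'.
  (* The arcs of [cyc e'] lie in the tree or over [e'], so none of them lies over [e], in either
     direction. *)
  have notin v : [set v.1; v.2] = e -> v \notin cycle_arcs (cyc e').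
    move=> ve; apply/negP => /(cycle_arcs_adj gc) /orP[Tv|].
      by move: eE; rewrite -ve EP Tv.
    by rewrite ve (negPf ne).
  rewrite flow_signed_arc_vec // (negPf (notin _ ue)) (negPf (notin _ _)).
    by rewrite subrr.
  by rewrite /= setUC.
(* The path ends at [b] and starts elsewhere, so the value is -1. *)
have zb_diag : {in enum (S :\ a), forall b, outflow R adj b (zb b) != 0}.
  move=> b; rewrite mem_enum => bS; rewrite zb_div // eqxx.
  by move: bS; rewrite !inE eq_sym => /andP[/negPf-> _]; rewrite sub0r oppr_eq0 oner_eq0.
have zb_off : {in enum (S :\ a) &, forall b b', b != b' ->
    outflow R adj b (zb b') = 0}.
  move=> b b'; rewrite !mem_enum => bS bS' ne; rewrite zb_div // eq_sym.
  move: bS; rewrite !inE => /andP[/negPf-> _].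
  by rewrite eq_sym (negPf ne) subrr.
have eigP z := mem_eigenspace1 (S := S) adj_sym z adj_conn adj_reg a_in_S.
split; last first.
  by move=> z; rewrite mem_cat => /orP[]/mapP[j _ ->] i; rewrite mxE !inE;
    case: ifP => _; [|case: ifP => _| |case: ifP => _]; rewrite ?eqxx ?orbT.
have B_sub : (<<B>> <= col_eigenspace (transition_mx R adj k S) 1)%VS.
  apply/span_subvP => z; rewrite mem_cat.
  case/orP=> /mapP[j]; rewrite mem_enum => jE ->; apply/eigP.
    by split=> [|x _]; [apply: ze_anti | apply: ze_div].
  split=> [|x xS]; first exact: zb_anti.
  (* Both ends of the path are marked, so the unmarked [x] is neither. *)
  rewrite zb_div //; move: jE; rewrite !inE => /andP[_ jS].
  by rewrite !(negPf (contraNneq _ xS)) ?subrr // => <-.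
rewrite /basis_of eqEsubv B_sub /=; apply/andP; split; last first.
  (* The path vectors are put first: outflows kill every cycle vector, whereas [flow] at [rep e]
     need not kill a path vector. *)
  rewrite (perm_free (permEl (perm_catC _ _))).
  apply: (free_map_cat zb_diag zb_off); first exact: enum_uniq.
    rewrite -[map _ _]cats0; apply: (free_map_cat ze_diag ze_off) => //.
      exact: enum_uniq.
    exact: nil_free.
  by move=> b z _ /mapP[e]; rewrite mem_enum => eE ->; apply: ze_div.
apply/subvP => z zU.
(* The path part [w] is subtracted first; the cycle part [w'] subtracted next has no outflow, so it
   leaves the outflows as they are. *)
have [w wB w_div] := reduce_modulo_span zb_diag zb_off z (enum_uniq _).
have [w' wB' w_flow] := reduce_modulo_span ze_diag ze_off (z - w) (enum_uniq _).
have {}wB : w \in <<B>>%VS.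
  by apply: subvP wB; apply: sub_span => y; rewrite mem_cat => ->; rewrite orbT.
have w'_div x : outflow R adj x w' = 0.
  apply: (scalar_span0 _ wB') => y /mapP[e]; rewrite mem_enum => eE ->.
  exact: ze_div.
have {}wB' : w' \in <<B>>%VS.
  by apply: subvP wB'; apply: sub_span => y; rewrite mem_cat => ->.
have wwU : z - w - w' \in col_eigenspace (transition_mx R adj k S) 1.
  by rewrite !memvB // (subvP B_sub).
have /eigP[d_anti d_unmarked] := wwU.
have d_div_ne x : x != a -> outflow R adj x (z - w - w') = 0.
  move=> x_a; case: (boolP (x \in S)) => xS; last exact: d_unmarked.
  by rewrite linearB /= w'_div w_div ?subr0 // mem_enum !inE x_a.
(* The outflows add up to 0, so the one at [a], which [w_div] does not cover, vanishes with the
   others. *)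
have d_div x : outflow R adj x (z - w - w') = 0.
  have [->|] := eqVneq x a; last exact: d_div_ne.
  have := outflow_sum0 d_anti; rewrite (bigD1 a) // big1 => [|x' /d_div_ne //].
  by rewrite /= addr0.
have d0 : z - w - w' = 0.
  apply: (acyclic_circulation_eq0 T_sym T_irr _ d_anti d_div) => [|u Tu].
    exact: spanning_tree_acyclic T_tree.
  case: (boolP (adj u.1 u.2)) => gu; last exact: flow_nonadj.
  have uE : [set u.1; u.2] \in edges adj :\: edges T by rewrite EP Tu.
  (* The chosen arc over this edge is [u] or its opposite; antisymmetry settles the second case. *)
  have flow_rep := w_flow [set u.1; u.2].
  have [_ /set2_eq[] rep_u] := repP _ uE; rewrite rep_u mem_enum uE in flow_rep.
    exact: flow_rep.
  by apply/eqP; rewrite -oppr_eq0 -d_anti flow_rep.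
by move/eqP: d0; rewrite subr_eq0 subr_eq => /eqP ->; rewrite memvD.
Qed.
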